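(* Let $\mathcal{A}$ be an abelian category, let $a,b$ be positive integers, let $N=a+b$, and let $\mathcal{B}$ be a full subcategory of $\operatorname{Seq}(\mathcal{A})$ containing $\mathrm{Com}_N(\mathcal{A})$. Then the functor $\mathrm{H}^{(a,b)}\circ[\ker d^N]$ on $\mathcal{B}$ can be written in the form $$\ker d^a\big/\left(\ker d^a\cap \operatorname{im} d^b\right)\quad\text{or}\quad \left(\ker d^a+\operatorname{im} d^b\right)\big/\operatorname{im} d^b ,$$ that is, it is naturally isomorphic to each of the two functors which send a sequence $C$ with differential $d$ to the indicated quotients (at each position $j$, with $\ker d^a=\ker(d^a:C_j\to C_{j+a})$ and $\operatorname{im} d^b=\operatorname{im}(d^b:C_{j-b}\to C_j)$, and with the maps induced by $d$ between consecutive positions).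
   Context: $\operatorname{Seq}(\mathcal{A})$ is the category whose objects (sequences) are families $C=(C_i)_{i\in\mathbb{Z}}$ of objects of $\mathcal{A}$ with arbitrary morphisms $d_i:C_i\to C_{i+1}$ (the differential $d$), and whose morphisms are families $f_i:C_i\to D_i$ commuting with the differentials. $\mathrm{Com}_N(\mathcal{A})$ (the $N$-complexes) is the full subcategory of sequences with $d^N=0$, i.e. $d_{i+N-1}\cdots d_i=0$ for all $i$. The functor $[\ker d^N]:\mathcal{B}\to\mathrm{Com}_N(\mathcal{A})$ sends $C$ to the subsequence which in degree $i$ is $\ker(d^N:C_i\to C_{i+N})$, with the restricted differential, and sends a morphism to its restriction. For an $N$-complex $C$ and positive integers $a,b$ with $a+b\ge N$, the Kapranov homology at position $j$ is $\mathrm{H}^{(a,b)}_j(C)=\ker(d^a:C_j\to C_{j+a})/\operatorname{im}(d^b:C_{j-b}\to C_j)$. The differential induces maps $\mathrm{H}^{(a,b)}_j(C)\to \mathrm{H}^{(a,b)}_{j+1}(C)$, and $\mathrm{H}^{(a,b)}$ denotes the resulting functor from $\mathrm{Com}_N(\mathcal{A})$ to $\mathrm{Com}_{\min(a,b)}(\mathcal{A})$. *)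

(* Defs.v *)
From HB Require Import structures.
From mathcomp Require Import all_boot all_order all_algebra.
From mathcomp Require Import boolp.

Set Implicit Arguments.
Unset Strict Implicit.
Unset Printing Implicit Defensive.

Import GRing.Theory.
Local Open Scope ring_scope.

Declare Scope cat_scope.
Delimit Scope cat_scope with cat.

Record category := Category {
  obj :> Type;
  hom : obj -> obj -> Type;
  idm : forall X : obj, hom X X;
  comp : forall X Y Z : obj, hom Y Z -> hom X Y -> hom X Z;
  compA : forall (W X Y Z : obj) (h : hom Y Z) (g : hom X Y) (f : hom W X),
    comp h (comp g f) = comp (comp h g) f;
  comp1m : forall (X Y : obj) (f : hom X Y), comp (idm Y) f = f;
  compm1 : forall (X Y : obj) (f : hom X Y), comp f (idm X) = f }.

Arguments hom {c} X Y.
Arguments idm {c} X.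
Arguments comp {c X Y Z} g f : rename.

Reserved Notation "g ∘ f" (at level 40, left associativity).
Notation "g ∘ f" := (comp g f) : cat_scope.
Local Open Scope cat_scope.

Definition mono (C : category) (X Y : C) (m : hom X Y) : Prop :=
  forall (Z : C) (f g : hom Z X), m ∘ f = m ∘ g -> f = g.

Definition epi (C : category) (X Y : C) (e : hom X Y) : Prop :=
  forall (Z : C) (f g : hom Y Z), f ∘ e = g ∘ e -> f = g.

Definition is_iso (C : category) (X Y : C) (f : hom X Y) : Prop :=
  exists g : hom Y X, g ∘ f = idm X /\ f ∘ g = idm Y.

Record functor (C D : category) := Functor {
  fobj :> C -> D;
  fmap : forall X Y : C, hom X Y -> hom (fobj X) (fobj Y);
  fmap1 : forall X : C, fmap (idm X) = idm (fobj X);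
  fmapM : forall (X Y Z : C) (g : hom Y Z) (f : hom X Y),
    fmap (g ∘ f) = fmap g ∘ fmap f }.

Definition functor_comp (C D E : category) (G : functor D E) (F : functor C D) :
  functor C E.
Proof.
refine (@Functor C E (fun X => G (F X)) (fun X Y f => fmap G (fmap F f)) _ _).
- by move=> X; rewrite !fmap1.
- by move=> X Y Z g f; rewrite !fmapM.
Defined.

Definition naturally_isomorphic (C D : category) (F G : functor C D) : Prop :=
  exists eta : forall X : C, hom (F X) (G X),
    (forall X : C, is_iso (eta X)) /\
    (forall (X Y : C) (f : hom X Y), eta Y ∘ fmap F f = fmap G f ∘ eta X).

Definition full_subcategory (C : category) (P : C -> Prop) : category.
Proof.
refine (@Category {X : C | P X} (fun X Y => hom (sval X) (sval Y))
  (fun X => idm (sval X)) (fun X Y Z g f => g ∘ f) _ _ _).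
- by move=> W X Y Z h g f; exact: compA.
- by move=> X Y f; exact: comp1m.
- by move=> X Y f; exact: compm1.
Defined.

(** The decidable equality and choice operator contained in [GRing.Zmodule]
    exist classically on every abelian group. *)
Record preadditive_category := PreadditiveCategory {
  preadd_cat :> category;
  hom_zmod : forall X Y : preadd_cat, GRing.Zmodule (hom X Y) }.

HB.instance Definition _ (A : preadditive_category) (X Y : A) :=
  @hom_zmod A X Y.

Definition is_kernel (A : preadditive_category) (X Y K : A) (f : hom X Y)
    (k : hom K X) : Prop :=
  f ∘ k = 0 /\
  forall (Z : A) (g : hom Z X), f ∘ g = 0 -> exists! h : hom Z K, k ∘ h = g.

Definition is_cokernel (A : preadditive_category) (X Y Q : A) (f : hom X Y)
    (q : hom Y Q) : Prop :=
  q ∘ f = 0 /\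
  forall (Z : A) (g : hom Y Z), g ∘ f = 0 -> exists! h : hom Q Z, h ∘ q = g.

(** The zero object, biproducts, kernels and cokernels are part of the data, so
    that the functors below are defined for any choice of them. *)
Record abelian_category := AbelianCategory {
  abel_preadd :> preadditive_category;
  compDl : forall (X Y Z : abel_preadd) (g h : hom Y Z) (f : hom X Y),
    (g + h) ∘ f = g ∘ f + h ∘ f;
  compDr : forall (X Y Z : abel_preadd) (g : hom Y Z) (f h : hom X Y),
    g ∘ (f + h) = g ∘ f + g ∘ h;
  zobj : abel_preadd;
  zobj_terminal : forall (X : abel_preadd) (f : hom X zobj), f = 0;
  zobj_initial : forall (X : abel_preadd) (f : hom zobj X), f = 0;
  biprod : abel_preadd -> abel_preadd -> abel_preadd;
  bin1 : forall X Y : abel_preadd, hom X (biprod X Y);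
  bin2 : forall X Y : abel_preadd, hom Y (biprod X Y);
  bpr1 : forall X Y : abel_preadd, hom (biprod X Y) X;
  bpr2 : forall X Y : abel_preadd, hom (biprod X Y) Y;
  bpr1_in1 : forall X Y : abel_preadd, bpr1 X Y ∘ bin1 X Y = idm X;
  bpr2_in2 : forall X Y : abel_preadd, bpr2 X Y ∘ bin2 X Y = idm Y;
  bpr1_in2 : forall X Y : abel_preadd, bpr1 X Y ∘ bin2 X Y = 0;
  bpr2_in1 : forall X Y : abel_preadd, bpr2 X Y ∘ bin1 X Y = 0;
  biprod_id : forall X Y : abel_preadd,
    bin1 X Y ∘ bpr1 X Y + bin2 X Y ∘ bpr2 X Y = idm (biprod X Y);
  ker : forall X Y : abel_preadd, hom X Y -> abel_preadd;
  kerm : forall (X Y : abel_preadd) (f : hom X Y), hom (ker f) X;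
  kermP : forall (X Y : abel_preadd) (f : hom X Y), is_kernel f (kerm f);
  coker : forall X Y : abel_preadd, hom X Y -> abel_preadd;
  cokerm : forall (X Y : abel_preadd) (f : hom X Y), hom Y (coker f);
  cokermP : forall (X Y : abel_preadd) (f : hom X Y), is_cokernel f (cokerm f);
  mono_normal : forall (X Y : abel_preadd) (m : hom X Y), mono m ->
    exists (Z : abel_preadd) (f : hom Y Z), is_kernel f m;
  epi_conormal : forall (X Y : abel_preadd) (e : hom X Y), epi e ->
    exists (Z : abel_preadd) (f : hom Z X), is_cokernel f e }.

Section Abelian.
Variable A : abelian_category.

Lemma comp0m (X Y Z : A) (f : hom X Y) : (0 : hom Y Z) ∘ f = 0.
Proof. by apply: (addrI (0 ∘ f)); rewrite -compDl !addr0. Qed.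

Lemma compm0 (X Y Z : A) (g : hom Y Z) : g ∘ (0 : hom X Y) = 0.
Proof. by apply: (addrI (g ∘ 0)); rewrite -compDr !addr0. Qed.

Lemma compNl (X Y Z : A) (g : hom Y Z) (f : hom X Y) : (- g) ∘ f = - (g ∘ f).
Proof. by apply: (addrI (g ∘ f)); rewrite -compDl !subrr comp0m. Qed.

Lemma compNr (X Y Z : A) (g : hom Y Z) (f : hom X Y) : g ∘ (- f) = - (g ∘ f).
Proof. by apply: (addrI (g ∘ f)); rewrite -compDr !subrr compm0. Qed.

Lemma compBl (X Y Z : A) (g h : hom Y Z) (f : hom X Y) :
  (g - h) ∘ f = g ∘ f - h ∘ f.
Proof. by rewrite compDl compNl. Qed.

Lemma compBr (X Y Z : A) (g : hom Y Z) (f h : hom X Y) :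
  g ∘ (f - h) = g ∘ f - g ∘ h.
Proof. by rewrite compDr compNr. Qed.

Lemma is_kernel_mono (X Y K : A) (f : hom X Y) (k : hom K X) :
  is_kernel f k -> mono k.
Proof.
move=> [fk0 kU] Z g h e.
have [|u [_ uU]] := kU Z (k ∘ g); first by rewrite compA fk0 comp0m.
by rewrite -(uU g) ?(uU h).
Qed.

Lemma is_cokernel_epi (X Y Q : A) (f : hom X Y) (q : hom Y Q) :
  is_cokernel f q -> epi q.
Proof.
move=> [qf0 qU] Z g h e.
have [|u [_ uU]] := qU Z (g ∘ q); first by rewrite -compA qf0 compm0.
by rewrite -(uU g) ?(uU h).
Qed.

Lemma kerm_mono (X Y : A) (f : hom X Y) : mono (kerm f).
Proof. exact: is_kernel_mono (kermP f). Qed.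

Lemma cokerm_epi (X Y : A) (f : hom X Y) : epi (cokerm f).
Proof. exact: is_cokernel_epi (cokermP f). Qed.

Lemma kerm0 (X Y : A) (f : hom X Y) : f ∘ kerm f = 0.
Proof. by case: (kermP f). Qed.

Lemma cokerm0 (X Y : A) (f : hom X Y) : cokerm f ∘ f = 0.
Proof. by case: (cokermP f). Qed.

Lemma kerm_factor (X Y Z : A) (f : hom X Y) (g : hom Z X) :
  f ∘ g = 0 -> exists h, kerm f ∘ h = g.
Proof. by case: (kermP f) => _ U /U [h [hE _]]; exists h. Qed.

Lemma cokerm_factor (X Y Z : A) (f : hom X Y) (g : hom Y Z) :
  g ∘ f = 0 -> exists h, h ∘ cokerm f = g.
Proof. by case: (cokermP f) => _ U /U [h [hE _]]; exists h. Qed.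

Record subobject (X : A) := Subobject {
  sub_obj :> A;
  sub_map : hom sub_obj X;
  sub_mono : mono sub_map }.

(** When it exists, [u] is unique, as [sub_map T] is mono; [restr] below is
    therefore independent of the choice made, and likewise for [incl] and
    [quot_map]. *)
Definition maps_into (X Y : A) (f : hom X Y) (S : subobject X)
    (T : subobject Y) : Prop :=
  exists u : hom S T, sub_map T ∘ u = f ∘ sub_map S.

Definition sub_le (X : A) (T S : subobject X) : Prop :=
  exists u : hom T S, sub_map S ∘ u = sub_map T.

Definition restr (X Y : A) (f : hom X Y) (S : subobject X) (T : subobject Y)
  (h : maps_into f S T) : hom S T := sval (cid h).

Lemma restrE (X Y : A) (f : hom X Y) (S : subobject X) (T : subobject Y)
  (h : maps_into f S T) : sub_map T ∘ restr h = f ∘ sub_map S.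
Proof. exact: (svalP (cid h)). Qed.

Definition incl (X : A) (T S : subobject X) (h : sub_le T S) : hom T S :=
  sval (cid h).

Lemma inclE (X : A) (T S : subobject X) (h : sub_le T S) :
  sub_map S ∘ incl h = sub_map T.
Proof. exact: (svalP (cid h)). Qed.

Lemma maps_into_le (X Y : A) (f : hom X Y) (S S' : subobject X)
    (T T' : subobject Y) :
  sub_le S' S -> sub_le T T' -> maps_into f S T -> maps_into f S' T'.
Proof.
move=> [i iE] [j jE] [u uE]; exists (j ∘ u ∘ i).
by rewrite !compA jE uE -compA iE.
Qed.

Lemma maps_into_comp (X Y Z : A) (g : hom Y Z) (f : hom X Y)
    (S : subobject X) (T : subobject Y) (U : subobject Z) :
  maps_into g T U -> maps_into f S T -> maps_into (g ∘ f) S U.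
Proof.
move=> [v vE] [u uE]; exists (v ∘ u).
by rewrite compA vE -compA uE compA.
Qed.

Definition ker_sub (X Y : A) (f : hom X Y) : subobject X :=
  Subobject (@kerm_mono _ _ f).

(** The image as the kernel of the cokernel. *)
Definition im_sub (X Y : A) (f : hom X Y) : subobject Y := ker_sub (cokerm f).

Lemma im_sub_factor (X Y : A) (f : hom X Y) :
  exists u, sub_map (im_sub f) ∘ u = f.
Proof. by apply: kerm_factor; rewrite cokerm0. Qed.

Lemma maps_into_ker (X X' Y Y' : A) (f : hom X Y) (f' : hom X' Y')
    (u : hom X X') (v : hom Y Y') :
  f' ∘ u = v ∘ f -> maps_into u (ker_sub f) (ker_sub f').
Proof.
by move=> e; apply: kerm_factor; rewrite compA e -compA kerm0 compm0.
Qed.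

Lemma maps_into_im (X X' Y Y' : A) (f : hom X Y) (f' : hom X' Y')
    (u : hom X X') (v : hom Y Y') :
  f' ∘ u = v ∘ f -> maps_into v (im_sub f) (im_sub f').
Proof.
move=> e; have [|w wE] := @cokerm_factor _ _ _ f (cokerm f' ∘ v).
  by rewrite -compA -e compA cokerm0 comp0m.
exact: maps_into_ker (esym wE).
Qed.

Lemma im_sub0 (X Y Z : A) (f : hom X Y) (g : hom Y Z) :
  g ∘ f = 0 -> g ∘ sub_map (im_sub f) = 0.
Proof. by move=> /cokerm_factor[h <-]; rewrite -compA kerm0 compm0. Qed.

Definition sub_diff (X : A) (S T : subobject X) : hom (biprod S T) X :=
  sub_map S ∘ bpr1 S T - sub_map T ∘ bpr2 S T.

Definition sub_sum (X : A) (S T : subobject X) : hom (biprod S T) X :=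
  sub_map S ∘ bpr1 S T + sub_map T ∘ bpr2 S T.

Lemma biprod_ext (X Y Z : A) (f g : hom Z (biprod X Y)) :
  bpr1 X Y ∘ f = bpr1 X Y ∘ g -> bpr2 X Y ∘ f = bpr2 X Y ∘ g -> f = g.
Proof.
move=> e1 e2; rewrite -(comp1m f) -(comp1m g) -biprod_id !compDl.
by rewrite -!compA e1 e2.
Qed.

Lemma sub_meet_eq (X : A) (S T : subobject X) :
  sub_map S ∘ (bpr1 S T ∘ kerm (sub_diff S T)) =
  sub_map T ∘ (bpr2 S T ∘ kerm (sub_diff S T)).
Proof.
by apply/eqP; rewrite -subr_eq0 !compA -compBl -/(sub_diff S T) kerm0.
Qed.

Lemma sub_meet_mono (X : A) (S T : subobject X) :
  mono (sub_map S ∘ (bpr1 S T ∘ kerm (sub_diff S T))).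
Proof.
move=> Z f g e; apply: kerm_mono; apply: biprod_ext.
  by rewrite !compA; apply: (@sub_mono _ S); rewrite !compA -!compA in e *.
move: e; rewrite sub_meet_eq => e.
by rewrite !compA; apply: (@sub_mono _ T); rewrite !compA -!compA in e *.
Qed.

(** The intersection is the pullback of the two inclusions, constructed as the
    kernel of [(s, t) |-> s - t] on the biproduct. *)
Definition sub_meet (X : A) (S T : subobject X) : subobject X :=
  Subobject (@sub_meet_mono X S T).

(** The sum is the image of [(s, t) |-> s + t] on the biproduct. *)
Definition sub_join (X : A) (S T : subobject X) : subobject X :=
  im_sub (sub_sum S T).

Lemma sub_meet_le1 (X : A) (S T : subobject X) : sub_le (sub_meet S T) S.
Proof. by exists (bpr1 S T ∘ kerm (sub_diff S T)). Qed.

Lemma sub_meet_le2 (X : A) (S T : subobject X) : sub_le (sub_meet S T) T.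
Proof.
by exists (bpr2 S T ∘ kerm (sub_diff S T)); rewrite /= sub_meet_eq.
Qed.

Lemma maps_into_meet (X Y : A) (f : hom X Y) (R : subobject X)
    (S T : subobject Y) :
  maps_into f R S -> maps_into f R T -> maps_into f R (sub_meet S T).
Proof.
move=> [u uE] [v vE].
have p1 : bpr1 S T ∘ (bin1 S T ∘ u + bin2 S T ∘ v) = u.
  by rewrite compDr !compA bpr1_in1 bpr1_in2 comp1m comp0m addr0.
have p2 : bpr2 S T ∘ (bin1 S T ∘ u + bin2 S T ∘ v) = v.
  by rewrite compDr !compA bpr2_in1 bpr2_in2 comp1m comp0m add0r.
have [|w wE] := @kerm_factor _ _ _ (sub_diff S T) (bin1 S T ∘ u + bin2 S T ∘ v).
  by rewrite compBl -!compA p1 p2 uE vE subrr.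
by exists w; rewrite /= -!compA wE p1.
Qed.

Lemma sub_join_ge1 (X : A) (S T : subobject X) : sub_le S (sub_join S T).
Proof.
have [u uE] := im_sub_factor (sub_sum S T); exists (u ∘ bin1 S T).
rewrite compA [sub_map _ ∘ u]uE compDl -!compA.
by rewrite bpr1_in1 bpr2_in1 compm1 compm0 addr0.
Qed.

Lemma sub_join_ge2 (X : A) (S T : subobject X) : sub_le T (sub_join S T).
Proof.
have [u uE] := im_sub_factor (sub_sum S T); exists (u ∘ bin2 S T).
rewrite compA [sub_map _ ∘ u]uE compDl -!compA.
by rewrite bpr1_in2 bpr2_in2 compm1 compm0 add0r.
Qed.

Lemma maps_into_join (X Y : A) (f : hom X Y) (S T : subobject X)
    (R : subobject Y) :
  maps_into f S R -> maps_into f T R -> maps_into f (sub_join S T) R.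
Proof.
move=> [u uE] [v vE]; have [Z [c cP]] := mono_normal (@sub_mono _ R).
have c0 := cP.1.
have [|h [hE _]] := cP.2 _ (f ∘ sub_map (sub_join S T)); last by exists h.
rewrite compA; apply: im_sub0; rewrite compDr !compA.
rewrite -[c ∘ f ∘ sub_map S]compA -uE -[c ∘ f ∘ sub_map T]compA -vE.
by rewrite !compA c0 !comp0m addr0.
Qed.

Definition quot (X : A) (S T : subobject X) (le : sub_le T S) : A :=
  coker (incl le).

Definition quot_proj (X : A) (S T : subobject X) (le : sub_le T S) :
  hom S (quot le) := cokerm (incl le).

Lemma quot_proj_epi (X : A) (S T : subobject X) (le : sub_le T S) :
  epi (quot_proj le).
Proof. exact: cokerm_epi. Qed.

Lemma quot_map_ex (X Y : A) (f : hom X Y) (S T : subobject X)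
    (S' T' : subobject Y) (le : sub_le T S) (le' : sub_le T' S')
    (hS : maps_into f S S') (hT : maps_into f T T') :
  exists h : hom (quot le) (quot le'),
    h ∘ quot_proj le = quot_proj le' ∘ restr hS.
Proof.
apply: cokerm_factor; rewrite -compA.
suff -> : restr hS ∘ incl le = incl le' ∘ restr hT.
  by rewrite compA cokerm0 comp0m.
apply: (@sub_mono _ S').
by rewrite !compA restrE inclE restrE -compA inclE.
Qed.

Definition quot_map (X Y : A) (f : hom X Y) (S T : subobject X)
    (S' T' : subobject Y) (le : sub_le T S) (le' : sub_le T' S')
    (hS : maps_into f S S') (hT : maps_into f T T') :
  hom (quot le) (quot le') := sval (cid (quot_map_ex le le' hS hT)).

Lemma quot_mapE (X Y : A) (f : hom X Y) (S T : subobject X)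
    (S' T' : subobject Y) (le : sub_le T S) (le' : sub_le T' S')
    (hS : maps_into f S S') (hT : maps_into f T T') :
  quot_map le le' hS hT ∘ quot_proj le = quot_proj le' ∘ restr hS.
Proof. exact: (svalP (cid (quot_map_ex le le' hS hT))). Qed.

Record sequence := Sequence {
  seq_obj :> int -> A;
  seq_d : forall i : int, hom (seq_obj i) (seq_obj (i + 1)) }.

Record seq_hom (C D : sequence) := SeqHom {
  seq_map :> forall i : int, hom (C i) (D i);
  seq_mapd : forall i : int,
    seq_map (i + 1) ∘ seq_d C i = seq_d D i ∘ seq_map i }.

Lemma seq_hom_ext (C D : sequence) (f g : seq_hom C D) :
  (forall i, f i = g i) -> f = g.
Proof.
case: f g => f fd [g gd] /= e.
have fg : f = g by apply: functional_extensionality_dep.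
by move: fd gd; rewrite fg => fd gd; rewrite (Prop_irrelevance fd gd).
Qed.

Lemma seq_idm_comm (C : sequence) (i : int) :
  idm (C (i + 1)) ∘ seq_d C i = seq_d C i ∘ idm (C i).
Proof. by rewrite comp1m compm1. Qed.

Definition seq_idm (C : sequence) : seq_hom C C := SeqHom (@seq_idm_comm C).

Lemma seq_comp_comm (C D E : sequence) (g : seq_hom D E) (f : seq_hom C D)
    (i : int) :
  g (i + 1) ∘ f (i + 1) ∘ seq_d C i = seq_d E i ∘ (g i ∘ f i).
Proof. by rewrite -compA seq_mapd compA seq_mapd compA. Qed.

Definition seq_comp (C D E : sequence) (g : seq_hom D E) (f : seq_hom C D) :
  seq_hom C E := SeqHom (@seq_comp_comm C D E g f).

Definition Seq : category.
Proof.
refine (@Category sequence seq_hom seq_idm seq_comp _ _ _).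
- by move=> W X Y Z h g f; apply: seq_hom_ext => i /=; rewrite compA.
- by move=> X Y f; apply: seq_hom_ext => i /=; rewrite comp1m.
- by move=> X Y f; apply: seq_hom_ext => i /=; rewrite compm1.
Defined.

(** The identity of [C i] transported along [i = j]: [i + n + 1] and
    [i + n.+1], or [j - n + n] and [j], are equal but not convertible. *)
Definition eqhom (C : sequence) (i j : int) (e : i = j) : hom (C i) (C j) :=
  match e in _ = k return hom (C i) (C k) with erefl => idm (C i) end.

Lemma dpow_shift0 (i : int) : i = i + 0%N%:Z.
Proof. exact: esym (addr0 i). Qed.

Lemma dpow_shiftS (n : nat) (i : int) : i + n%:Z + 1 = i + n.+1%:Z.
Proof. by rewrite -addrA -PoszD addn1. Qed.

Fixpoint dpow (C : sequence) (n : nat) (i : int) {struct n} :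
    hom (C i) (C (i + n%:Z)) :=
  match n with
  | 0 => eqhom C (dpow_shift0 i)
  | n'.+1 => eqhom C (dpow_shiftS n' i) ∘ (seq_d C (i + n'%:Z) ∘ dpow C n' i)
  end.

(** [d^n] with target [C_j], for the image of [d^n : C_(j-n) -> C_j]. *)
Definition dpow_to (C : sequence) (n : nat) (j : int) :
    hom (C (j - n%:Z)) (C j) :=
  eqhom C (subrK n%:Z j) ∘ dpow C n (j - n%:Z).

Definition is_complex (N : nat) (C : Seq) : Prop :=
  forall i : int, dpow C N i = 0.

Definition Com (N : nat) : category := full_subcategory (is_complex N).

Lemma eqhom_id (C : sequence) (i : int) (e : i = i) : eqhom C e = idm (C i).
Proof. by rewrite (eq_irrelevance e erefl). Qed.

Lemma eqhom_comp (C : sequence) (i j k : int) (e : i = j) (e' : j = k)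
  (e'' : i = k) : eqhom C e' ∘ eqhom C e = eqhom C e''.
Proof.
by case: _ / e' e'' => e''; rewrite (eq_irrelevance e'' e) eqhom_id comp1m.
Qed.

Lemma eqhom_d (C : sequence) (i j : int) (e : i = j) (e' : i + 1 = j + 1) :
  eqhom C e' ∘ seq_d C i = seq_d C j ∘ eqhom C e.
Proof. by case: _ / e e' => e'; rewrite eqhom_id compm1 comp1m. Qed.

Lemma eqhom_dpow (C : sequence) (n : nat) (i j : int) (e : i = j)
    (e' : i + n%:Z = j + n%:Z) :
  eqhom C e' ∘ dpow C n i = dpow C n j ∘ eqhom C e.
Proof. by case: _ / e e' => e'; rewrite eqhom_id compm1 comp1m. Qed.

Lemma eqhom_nat (C D : sequence) (f : forall i, hom (C i) (D i)) (i j : int)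
    (e : i = j) :
  f j ∘ eqhom C e = eqhom D e ∘ f i.
Proof. by case: _ / e; rewrite compm1 comp1m. Qed.

Lemma dpow_nat (C D : sequence) (f : seq_hom C D) (n : nat) (i : int) :
  f (i + n%:Z) ∘ dpow C n i = dpow D n i ∘ f i.
Proof.
elim: n => [|n IHn] /=; first exact: eqhom_nat.
rewrite compA eqhom_nat -!compA; congr (comp _ _).
by rewrite compA seq_mapd -!compA IHn.
Qed.

Lemma dpow_to_nat (C D : sequence) (f : seq_hom C D) (n : nat) (j : int) :
  f j ∘ dpow_to C n j = dpow_to D n j ∘ f (j - n%:Z).
Proof. by rewrite /dpow_to compA eqhom_nat -compA dpow_nat compA. Qed.

Lemma dpow_d (C : sequence) (n : nat) (i : int)
    (e : i + n%:Z + 1 = i + 1 + n%:Z) :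
  dpow C n (i + 1) ∘ seq_d C i = eqhom C e ∘ (seq_d C (i + n%:Z) ∘ dpow C n i).
Proof.
elim: n e => [|n IHn] e /=.
  have e0 : i + 1 = i + 0%N%:Z + 1 by rewrite -dpow_shift0.
  by rewrite -(eqhom_d C (dpow_shift0 i) e0) compA (eqhom_comp _ _ _ (dpow_shift0 (i + 1))).
have e1 : i + n%:Z + 1 = i + 1 + n%:Z by rewrite addrAC.
rewrite -!compA (IHn e1).
rewrite [seq_d C (i + 1 + n%:Z) ∘ _]compA.
have e2 : i + n%:Z + 1 + 1 = i + 1 + n%:Z + 1 by rewrite e1.
rewrite -(eqhom_d C e1 e2).
have e3 : i + n%:Z + 1 + 1 = i + n.+1%:Z + 1 by rewrite dpow_shiftS.
rewrite [seq_d C (i + n.+1%:Z) ∘ _]compA -(eqhom_d C (dpow_shiftS n i) e3).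
have e4 : i + n%:Z + 1 + 1 = i + 1 + n.+1%:Z by rewrite -dpow_shiftS e1.
by rewrite !compA (eqhom_comp _ _ _ e4) (eqhom_comp _ _ _ e4).
Qed.

Lemma dpow_to_d (C : sequence) (n : nat) (j : int)
    (e : j - n%:Z + 1 = j + 1 - n%:Z) :
  seq_d C j ∘ dpow_to C n j =
  dpow_to C n (j + 1) ∘ (eqhom C e ∘ seq_d C (j - n%:Z)).
Proof.
rewrite /dpow_to -compA [dpow C n _ ∘ _]compA.
have e1 : j - n%:Z + 1 + n%:Z = j + 1 - n%:Z + n%:Z by rewrite e.
rewrite -(eqhom_dpow C e e1) -compA.
have e2 : j - n%:Z + n%:Z + 1 = j - n%:Z + 1 + n%:Z by rewrite addrAC.
rewrite (dpow_d C e2).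
have e3 : j - n%:Z + n%:Z + 1 = j + 1 by rewrite subrK.
rewrite compA -(eqhom_d C (subrK n%:Z j) e3) -compA.
have e4 : j - n%:Z + 1 + n%:Z = j + 1 by rewrite e subrK.
by rewrite 2![RHS]compA (eqhom_comp _ _ _ e4) (eqhom_comp _ _ _ e3).
Qed.

Lemma dpowE_to (C : sequence) (n : nat) (i : int)
    (e : i = i + n%:Z - n%:Z) :
  dpow C n i = dpow_to C n (i + n%:Z) ∘ eqhom C e.
Proof.
rewrite /dpow_to -compA.
have e1 : i + n%:Z = i + n%:Z - n%:Z + n%:Z by rewrite -e.
by rewrite -(eqhom_dpow C e e1) compA (eqhom_comp _ _ _ erefl) comp1m.
Qed.

Lemma dpow_add (C : sequence) (m n : nat) (i : int)
    (e : i + n%:Z + m%:Z = i + (m + n)%N%:Z) :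
  dpow C (m + n) i = eqhom C e ∘ (dpow C m (i + n%:Z) ∘ dpow C n i).
Proof.
elim: m e => [|m IHm] e.
  by rewrite /= compA (eqhom_comp _ _ _ erefl) comp1m.
have e1 : i + n%:Z + m%:Z = i + (m + n)%N%:Z by rewrite PoszD -addrA [n%:Z + _]addrC.
rewrite /= (IHm e1) ![seq_d C _ ∘ (eqhom _ _ ∘ _)]compA.
have e2 : i + n%:Z + m%:Z + 1 = i + (m + n)%N%:Z + 1 by rewrite e1.
rewrite -(eqhom_d C e1 e2) !compA.
have e3 : i + n%:Z + m%:Z + 1 = i + (m.+1 + n)%N%:Z.
  by rewrite e2 dpow_shiftS.
by rewrite (eqhom_comp _ _ _ e3) (eqhom_comp _ _ _ e3).
Qed.

Lemma complex_dpow0 (C : sequence) (N a b : nat) (j : int) :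
  is_complex N C -> (N <= a + b)%N -> dpow C a j ∘ dpow_to C b j = 0.
Proof.
move=> CN leN.
have C0 i : dpow C (a + b) i = 0.
  have e : i + N%:Z + (a + b - N)%N%:Z = i + (a + b - N + N)%N%:Z.
    by rewrite -addrA -PoszD addnC.
  by rewrite -(subnK leN) (dpow_add C e) CN !compm0.
have e1 : j - b%:Z + b%:Z + a%:Z = j + a%:Z by rewrite subrK.
rewrite /dpow_to compA -(eqhom_dpow C (subrK b%:Z j) e1).
have e2 : j - b%:Z + b%:Z + a%:Z = j - b%:Z + (a + b)%N%:Z.
  by rewrite PoszD -addrA [b%:Z + _]addrC.
have e3 : j - b%:Z + (a + b)%N%:Z = j + a%:Z by rewrite -e2 e1.
by rewrite -(eqhom_comp C e2 e3 e1) -!compA -(dpow_add C e2) C0 compm0.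
Qed.

(** A functorial choice of a subsequence of each sequence. *)
Record subfunctor := Subfunctor {
  subf :> forall (C : sequence) (j : int), subobject (C j);
  subf_d : forall (C : sequence) (j : int),
    maps_into (seq_d C j) (subf C j) (subf C (j + 1));
  subf_map : forall (C D : sequence) (f : seq_hom C D) (j : int),
    maps_into (f j) (subf C j) (subf D j) }.

Lemma ker_d_d (n : nat) (C : sequence) (j : int) :
  maps_into (seq_d C j) (ker_sub (dpow C n j)) (ker_sub (dpow C n (j + 1))).
Proof.
have e : j + n%:Z + 1 = j + 1 + n%:Z by rewrite addrAC.
by apply: maps_into_ker; rewrite (dpow_d C e) compA; reflexivity.
Qed.

Lemma ker_d_map (n : nat) (C D : sequence) (f : seq_hom C D) (j : int) :
  maps_into (f j) (ker_sub (dpow C n j)) (ker_sub (dpow D n j)).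
Proof. by apply: maps_into_ker; rewrite -dpow_nat; reflexivity. Qed.

Definition ker_d (n : nat) : subfunctor :=
  @Subfunctor (fun C j => ker_sub (dpow C n j)) (ker_d_d n) (ker_d_map n).

Lemma im_d_d (n : nat) (C : sequence) (j : int) :
  maps_into (seq_d C j) (im_sub (dpow_to C n j)) (im_sub (dpow_to C n (j + 1))).
Proof.
have e : j - n%:Z + 1 = j + 1 - n%:Z by rewrite addrAC.
by apply: maps_into_im; rewrite (dpow_to_d C e); reflexivity.
Qed.

Lemma im_d_map (n : nat) (C D : sequence) (f : seq_hom C D) (j : int) :
  maps_into (f j) (im_sub (dpow_to C n j)) (im_sub (dpow_to D n j)).
Proof. by apply: maps_into_im; rewrite dpow_to_nat; reflexivity. Qed.

Definition im_d (n : nat) : subfunctor :=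
  @Subfunctor (fun C j => im_sub (dpow_to C n j)) (im_d_d n) (im_d_map n).

Definition meetf (S T : subfunctor) : subfunctor.
Proof.
refine (@Subfunctor (fun C j => sub_meet (S C j) (T C j)) _ _).
- move=> C j; apply: maps_into_meet.
  + exact: maps_into_le (sub_meet_le1 _ _) (ex_intro _ _ (compm1 _)) (subf_d S C j).
  + exact: maps_into_le (sub_meet_le2 _ _) (ex_intro _ _ (compm1 _)) (subf_d T C j).
- move=> C D f j; apply: maps_into_meet.
  + exact: maps_into_le (sub_meet_le1 _ _) (ex_intro _ _ (compm1 _)) (subf_map S f j).
  + exact: maps_into_le (sub_meet_le2 _ _) (ex_intro _ _ (compm1 _)) (subf_map T f j).
Defined.

Definition joinf (S T : subfunctor) : subfunctor.
Proof.
refine (@Subfunctor (fun C j => sub_join (S C j) (T C j)) _ _).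
- move=> C j; apply: maps_into_join.
  + exact: maps_into_le (ex_intro _ _ (compm1 _)) (sub_join_ge1 _ _) (subf_d S C j).
  + exact: maps_into_le (ex_intro _ _ (compm1 _)) (sub_join_ge2 _ _) (subf_d T C j).
- move=> C D f j; apply: maps_into_join.
  + exact: maps_into_le (ex_intro _ _ (compm1 _)) (sub_join_ge1 _ _) (subf_map S f j).
  + exact: maps_into_le (ex_intro _ _ (compm1 _)) (sub_join_ge2 _ _) (subf_map T f j).
Defined.

Definition sub_seq (S : subfunctor) (C : sequence) : sequence :=
  @Sequence (fun j => S C j) (fun j => restr (subf_d S C j)).

Lemma sub_seq_map_comm (S : subfunctor) (C D : sequence) (f : seq_hom C D)
    (j : int) :
  restr (subf_map S f (j + 1)) ∘ seq_d (sub_seq S C) j =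
  seq_d (sub_seq S D) j ∘ restr (subf_map S f j).
Proof.
apply: (@sub_mono _ (S D (j + 1))).
by rewrite !compA !restrE -!compA !restrE !compA seq_mapd.
Qed.

Definition sub_seq_map (S : subfunctor) (C D : sequence) (f : seq_hom C D) :
  seq_hom (sub_seq S C) (sub_seq S D) :=
  @SeqHom (sub_seq S C) (sub_seq S D) (fun j => restr (subf_map S f j))
    (sub_seq_map_comm S f).

Definition sub_functor (S : subfunctor) : functor Seq Seq.
Proof.
refine (@Functor Seq Seq (sub_seq S) (sub_seq_map S) _ _).
- move=> C; apply: seq_hom_ext => j; apply: (@sub_mono _ (S C j)).
  by rewrite restrE /= comp1m compm1.
- move=> C D E g f; apply: seq_hom_ext => j; apply: (@sub_mono _ (S E j)).
  by rewrite restrE /= compA restrE -!compA restrE.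
Defined.

Definition sub_seq_incl (S : subfunctor) (C : sequence) :
  seq_hom (sub_seq S C) C :=
  @SeqHom (sub_seq S C) C (fun j => sub_map (S C j))
    (fun j => restrE (subf_d S C j)).

Definition quot_seq (S T : subfunctor) (C : sequence)
    (le : forall j, sub_le (T C j) (S C j)) : sequence :=
  @Sequence (fun j => quot (le j))
    (fun j => quot_map (le j) (le (j + 1)) (subf_d S C j) (subf_d T C j)).

Lemma quot_seq_map_comm (S T : subfunctor) (C D : sequence)
    (leC : forall j, sub_le (T C j) (S C j))
    (leD : forall j, sub_le (T D j) (S D j)) (f : seq_hom C D) (j : int) :
  quot_map (leC (j + 1)) (leD (j + 1))
    (subf_map S f (j + 1)) (subf_map T f (j + 1)) ∘ seq_d (quot_seq leC) j =
  seq_d (quot_seq leD) j ∘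
    quot_map (leC j) (leD j) (subf_map S f j) (subf_map T f j).
Proof.
apply: (@quot_proj_epi _ _ _ (leC j)); rewrite -!compA !quot_mapE.
by rewrite !compA !quot_mapE -!compA; congr (comp _ _); apply: (sub_seq_map_comm S).
Qed.

Definition quot_seq_map (S T : subfunctor) (C D : sequence)
    (leC : forall j, sub_le (T C j) (S C j))
    (leD : forall j, sub_le (T D j) (S D j)) (f : seq_hom C D) :
  seq_hom (quot_seq leC) (quot_seq leD) :=
  @SeqHom (quot_seq leC) (quot_seq leD)
    (fun j => quot_map (leC j) (leD j) (subf_map S f j) (subf_map T f j))
    (quot_seq_map_comm leC leD f).

Definition quot_seq_proj (S T : subfunctor) (C : sequence)
    (le : forall j, sub_le (T C j) (S C j)) :
  seq_hom (sub_seq S C) (quot_seq le) :=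
  @SeqHom (sub_seq S C) (quot_seq le) (fun j => quot_proj (le j))
    (fun j => esym (quot_mapE (le j) (le (j + 1)) (subf_d S C j) (subf_d T C j))).

Lemma quot_seq_complex (S T : subfunctor) (C : sequence)
    (le : forall j, sub_le (T C j) (S C j)) (m : nat) :
  (forall j, maps_into (dpow C m j) (S C j) (T C (j + m%:Z))) ->
  is_complex m (quot_seq le).
Proof.
move=> dST j; apply: (@quot_proj_epi _ _ _ (le j)); rewrite comp0m.
rewrite -[LHS](dpow_nat (quot_seq_proj le)) /=.
have [u uE] := dST j.
suff -> : dpow (sub_seq S C) m j = incl (le (j + m%:Z)) ∘ u.
  by rewrite compA cokerm0 comp0m.
apply: (@sub_mono _ (S C (j + m%:Z))).
by rewrite compA inclE uE; apply: (dpow_nat (sub_seq_incl S C)).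
Qed.

(** The functor [C |-> S C / T C]; [le] and [dm] are only required on the
    sequences satisfying [P]. *)
Definition quot_functor (P : Seq -> Prop) (m : nat) (S T : subfunctor)
    (le : forall C, P C -> forall j, sub_le (T C j) (S C j))
    (dm : forall C, P C -> forall j,
       maps_into (dpow C m j) (S C j) (T C (j + m%:Z))) :
  functor (full_subcategory P) (Com m).
Proof.
refine (@Functor (full_subcategory P) (Com m)
  (fun C => exist _ (quot_seq (le (sval C) (svalP C)) : Seq)
     (quot_seq_complex (le (sval C) (svalP C)) (dm (sval C) (svalP C))))
  (fun C D f => quot_seq_map (le (sval C) (svalP C)) (le (sval D) (svalP D)) f)
  _ _).
- move=> C; apply: seq_hom_ext => j; apply: quot_proj_epi.
  rewrite quot_mapE /= comp1m -[RHS]compm1; congr (comp _ _).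
  by apply: sub_mono; rewrite restrE /= comp1m compm1.
- move=> C D E g f; apply: seq_hom_ext => j; apply: quot_proj_epi.
  rewrite quot_mapE /= -compA quot_mapE compA quot_mapE -compA; congr (comp _ _).
  by apply: sub_mono; rewrite restrE /= compA restrE -!compA restrE.
Defined.

Lemma ker_d_complex (N : nat) (C : sequence) :
  is_complex N (sub_seq (ker_d N) C).
Proof.
move=> j; apply: (@sub_mono _ (ker_d N C (j + N%:Z))).
rewrite compm0 -[RHS](kerm0 (dpow C N j)).
exact: (dpow_nat (sub_seq_incl (ker_d N) C)).
Qed.

Definition ker_functor (P : Seq -> Prop) (N : nat) :
  functor (full_subcategory P) (Com N).
Proof.
refine (@Functor (full_subcategory P) (Com N)
  (fun C => exist _ (sub_functor (ker_d N) (sval C)) (ker_d_complex N (sval C)))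
  (fun C D f => fmap (sub_functor (ker_d N)) f) _ _).
- by move=> C; exact: (fmap1 (sub_functor (ker_d N))).
- by move=> C D E g f; exact: (fmapM (sub_functor (ker_d N)) g f).
Defined.

Lemma subf_dpow (S : subfunctor) (C : sequence) (n : nat) (j : int) :
  maps_into (dpow C n j) (S C j) (S C (j + n%:Z)).
Proof.
exists (dpow (sub_seq S C) n j).
exact: (dpow_nat (sub_seq_incl S C)).
Qed.

Lemma ker_d_dpow0 (n : nat) (C : sequence) (j : int)
    (T : subobject (C (j + n%:Z))) :
  maps_into (dpow C n j) (ker_d n C j) T.
Proof. by exists 0; rewrite compm0 kerm0. Qed.

Lemma dpow_im_d (n : nat) (C : sequence) (j : int) (S : subobject (C j)) :
  maps_into (dpow C n j) S (im_d n C (j + n%:Z)).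
Proof.
have e : j = j + n%:Z - n%:Z by rewrite addrK.
have [u uE] := im_sub_factor (dpow_to C n (j + n%:Z)).
exists (u ∘ (eqhom C e ∘ sub_map S)).
rewrite (dpowE_to C e) -compA -[in RHS]uE; exact: compA.
Qed.

Lemma kapranov_le (N a b : nat) (leN : (N <= a + b)%N) (C : Seq) :
  is_complex N C -> forall j, sub_le (im_d b C j) (ker_d a C j).
Proof.
by move=> CN j; apply/kerm_factor/im_sub0/(complex_dpow0 _ CN leN).
Qed.

Lemma ker_im_dmin (a b : nat) (C : Seq) (j : int) :
  maps_into (dpow C (minn a b) j) (ker_d a C j) (im_d b C (j + (minn a b)%:Z)).
Proof.
by case: (leqP a b) => _; [exact: ker_d_dpow0 | exact: dpow_im_d].
Qed.

Definition kapranov (N a b : nat) (leN : (N <= a + b)%N) :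
  functor (Com N) (Com (minn a b)) :=
  quot_functor (kapranov_le leN) (fun C _ => @ker_im_dmin a b C).

Lemma ker_meet_le (a b : nat) (C : Seq) (j : int) :
  sub_le (meetf (ker_d a) (im_d b) C j) (ker_d a C j).
Proof. exact: sub_meet_le1. Qed.

Lemma ker_meet_dmin (a b : nat) (C : Seq) (j : int) :
  maps_into (dpow C (minn a b) j) (ker_d a C j)
    (meetf (ker_d a) (im_d b) C (j + (minn a b)%:Z)).
Proof.
apply: maps_into_meet; [exact: subf_dpow | exact: ker_im_dmin].
Qed.

Definition ker_mod_meet (P : Seq -> Prop) (a b : nat) :
  functor (full_subcategory P) (Com (minn a b)) :=
  quot_functor (fun (C : Seq) (_ : P C) => @ker_meet_le a b C)
    (fun C _ => @ker_meet_dmin a b C).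

Lemma join_im_le (a b : nat) (C : Seq) (j : int) :
  sub_le (im_d b C j) (joinf (ker_d a) (im_d b) C j).
Proof. exact: sub_join_ge2. Qed.

Lemma join_im_dmin (a b : nat) (C : Seq) (j : int) :
  maps_into (dpow C (minn a b) j) (joinf (ker_d a) (im_d b) C j)
    (im_d b C (j + (minn a b)%:Z)).
Proof.
apply: maps_into_join; [exact: ker_im_dmin | exact: subf_dpow].
Qed.

Definition join_mod_im (P : Seq -> Prop) (a b : nat) :
  functor (full_subcategory P) (Com (minn a b)) :=
  quot_functor (fun (C : Seq) (_ : P C) => @join_im_le a b C)
    (fun C _ => @join_im_dmin a b C).

End Abelian.

(* Main.v *)
(** Write [K] for [ker d^N] inside [C]. Since [ker d^a] is contained in [K], the
    kernel of [d^a] on [K] is that of [C]; and since [d^b y] lies in [ker d^a]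
    exactly when [y] lies in [K], the image of [d^b] on [K] is
    [ker d^a ∩ im d^b]. Hence the inclusion of [K] in [C] induces a map from the
    homology of [K] to [S / T], for both pairs [(S, T)] of the statement. It is
    mono because [T ⊆ im d^b] meets the kernel of [d^a] on [K] in the image of
    [d^b] on [K], and epi because [S] is generated by [ker d^a] and [T]. *)
Require Import Defs.
From mathcomp Require Import all_boot all_order all_algebra.
Import Defs.

Set Implicit Arguments.
Unset Strict Implicit.
Unset Printing Implicit Defensive.

Import GRing.Theory.
Local Open Scope ring_scope.
Local Open Scope cat_scope.

(** * Monos, epis and generalized elements in an abelian category *)

Section AbelianFacts.
Variable A : abelian_category.

Lemma epi_eq0 (X Y Z : A) (e : hom X Y) (h : hom Y Z) :
  epi e -> h ∘ e = 0 -> h = 0.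
Proof. by move=> eP he; apply: eP; rewrite he comp0m. Qed.

Lemma epiP (X Y : A) (e : hom X Y) :
  (forall (Z : A) (h : hom Y Z), h ∘ e = 0 -> h = 0) -> epi e.
Proof.
move=> eP Z f g efg; apply/eqP; rewrite -subr_eq0; apply/eqP/eP.
by rewrite compBl efg subrr.
Qed.

Lemma monoP (X Y : A) (m : hom X Y) :
  (forall (Z : A) (h : hom Z X), m ∘ h = 0 -> h = 0) -> mono m.
Proof.
move=> mP Z f g mfg; apply/eqP; rewrite -subr_eq0; apply/eqP/mP.
by rewrite compBr mfg subrr.
Qed.

(** A mono is the kernel of some [c]; if it is also epi, then [c = 0] and the identity factors
    through it. *)
Lemma mono_epi_iso (X Y : A) (f : hom X Y) : mono f -> epi f -> is_iso f.
Proof.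
move=> fm fe; have [Z [c [cf cU]]] := mono_normal fm.
have c0 : c = 0 by apply: epi_eq0 fe cf.
have [|g [fg _]] := cU _ (idm Y); first by rewrite c0 comp0m.
by exists g; split=> //; apply: fm; rewrite compA fg comp1m compm1.
Qed.

(** Any map with kernel [m] factors through [cokerm m], so [m] is the kernel of its own cokernel. *)
Lemma mono_factor_cokerm (X Y Z : A) (m : hom X Y) (x : hom Z Y) :
  mono m -> cokerm m ∘ x = 0 -> exists y, m ∘ y = x.
Proof.
move=> mm mx; have [W [c [cm cU]]] := mono_normal mm.
have [c' c'E] := cokerm_factor cm.
have [|y [yE _]] := cU _ x; first by rewrite -c'E -compA mx compm0.
by exists y.
Qed.

(** Since [e] cancels from [cokerm m ∘ x ∘ e = 0], membership in a subobject may be tested on a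
    cover. *)
Lemma mono_factor_epi (X Y W Z : A) (m : hom X Y) (x : hom Z Y) (e : hom W Z)
    (y : hom W X) :
  mono m -> epi e -> m ∘ y = x ∘ e -> exists z, m ∘ z = x.
Proof.
move=> mm ee my; apply: mono_factor_cokerm => //; apply: epi_eq0 ee _.
by rewrite -compA -my compA cokerm0 comp0m.
Qed.

Lemma epi_factor_kerm (X Y Z : A) (e : hom X Y) (x : hom X Z) :
  epi e -> x ∘ kerm e = 0 -> exists y, y ∘ e = x.
Proof.
move=> ee xk; have [W [c [ec cU]]] := epi_conormal ee.
have [c' c'E] := kerm_factor ec.
have [|y [yE _]] := cU _ x; first by rewrite -c'E compA xk comp0m.
by exists y.
Qed.

(* The pullback of [e] along [g] is the kernel of [(x, z) |-> e x - g z]. This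
   difference is epi, hence the cokernel of its kernel, so an [h] vanishing on
   the pullback is of the form [t e = 0] on [X] and [- t g] on [Z]. *)
Lemma epi_pullback (X Y Z : A) (e : hom X Y) (g : hom Z Y) :
  epi e -> exists (W : A) (e' : hom W Z) (g' : hom W X),
    epi e' /\ e ∘ g' = g ∘ e'.
Proof.
move=> ee; pose s := e ∘ bpr1 X Z - g ∘ bpr2 X Z.
have s1 : s ∘ bin1 X Z = e.
  by rewrite compBl -!compA bpr1_in1 bpr2_in1 compm1 compm0 subr0.
have se : epi s.
  apply: epiP => V h hs; apply: epi_eq0 ee _.
  by rewrite -s1 compA hs comp0m.
exists (ker s), (bpr2 X Z ∘ kerm s), (bpr1 X Z ∘ kerm s); split; last first.
  by apply/eqP; rewrite -subr_eq0 !compA -compBl -/s kerm0.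
apply: epiP => V h; rewrite compA => /(epi_factor_kerm se)[t tE].
have t0 : t = 0.
  by apply: epi_eq0 ee _; rewrite -s1 compA tE -compA bpr2_in1 compm0.
by rewrite -(compm1 h) -(bpr2_in2 X Z) compA -tE t0 !comp0m.
Qed.

(** If [h ∘ u = 0], then [f] factors through [ker h], a subobject of the image. The image is the
    least subobject through which [f] factors, so [ker h] is all of it. *)
Lemma im_sub_factor_epi (X Y : A) (f : hom X Y) (u : hom X (im_sub f)) :
  sub_map (im_sub f) ∘ u = f -> epi u.
Proof.
move=> uE; apply: epiP => Z h hu.
have [u' u'E] := kerm_factor hu.
have [||t tE] := @mono_factor_cokerm _ _ _
    (sub_map (im_sub f) ∘ kerm h) (sub_map (im_sub f)).
- move=> V p q; rewrite -!compA => /(@sub_mono _ _ _)/(@kerm_mono _ _ _ _).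
  exact.
- apply: im_sub0; rewrite -[X in _ ∘ X = _]uE -u'E.
  by rewrite [sub_map _ ∘ (_ ∘ _)]compA compA cokerm0 comp0m.
- have kt : kerm h ∘ t = idm _.
    by apply: (@sub_mono _ _ (im_sub f)); rewrite compA tE compm1.
  by rewrite -(compm1 h) -kt compA kerm0 comp0m.
Qed.

(** The biproduct covers the join by the map whose components are the two inclusions. *)
Lemma sub_join_ext (X Z : A) (S T : subobject X) (g : hom (sub_join S T) Z)
    (leS : sub_le S (sub_join S T)) (leT : sub_le T (sub_join S T)) :
  g ∘ incl leS = 0 -> g ∘ incl leT = 0 -> g = 0.
Proof.
move=> gS gT.
apply: (epi_eq0 (@im_sub_factor_epi _ _ (sub_sum S T)
  (incl leS ∘ bpr1 S T + incl leT ∘ bpr2 S T) _)).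
  rewrite compDr !compA.
  rewrite -[im_sub _]/(sub_join S T).
  by rewrite (inclE leS) (inclE leT).
by rewrite compDr !compA gS gT !comp0m addr0.
Qed.

(** The pullback along [x] of the cover of the image by [X] carries the preimage [y]. *)
Lemma im_sub_lift (X Y Z : A) (f : hom X Y) (x : hom Z (im_sub f)) :
  exists (W : A) (e : hom W Z) (y : hom W X),
    epi e /\ f ∘ y = sub_map (im_sub f) ∘ x ∘ e.
Proof.
have [u uE] := im_sub_factor f.
have [W [e [y [ee ye]]]] := epi_pullback x (im_sub_factor_epi uE).
by exists W, e, y; split=> //; rewrite -[in LHS]uE -compA ye compA.
Qed.

(** The first condition says that elements of [S] sent into [T'] lie in [T], which gives mono; the
    second, that [T'] and the image of [S] generate [S'], which gives epi. *)
Lemma quot_map_iso (X Y : A) (f : hom X Y) (S T : subobject X)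
    (S' T' : subobject Y) (le : sub_le T S) (le' : sub_le T' S')
    (hS : maps_into f S S') (hT : maps_into f T T') :
  (forall (W : A) (x : hom W S) (y : hom W T'),
     sub_map T' ∘ y = f ∘ (sub_map S ∘ x) ->
     exists z, sub_map T ∘ z = sub_map S ∘ x) ->
  (forall (Z : A) (g : hom S' Z),
     g ∘ restr hS = 0 -> g ∘ incl le' = 0 -> g = 0) ->
  is_iso (quot_map le le' hS hT).
Proof.
move=> preim gen; apply: mono_epi_iso.
  apply: monoP => Z z z0.
  (* On a cover, [z] lifts to an element [x] of [S], whose image dies modulo [T']. *)
  have [W [e [x [ee xE]]]] := epi_pullback z (@quot_proj_epi _ _ _ _ le).
  apply: epi_eq0 ee _.
  have [||y yE] := @mono_factor_cokerm _ _ _ (incl le') (restr hS ∘ x).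
  - move=> V p q /(congr1 (comp (sub_map S'))).
    by rewrite !compA inclE => /(@sub_mono _ _ T').
  - rewrite compA -[_ ∘ restr hS](quot_mapE le le' hS hT) -compA xE compA.
    by rewrite z0 comp0m.
  - have [|w wE] := preim _ x y.
      by rewrite compA -(restrE hS) -[RHS]compA -yE compA inclE.
    have iw : incl le ∘ w = x by apply: (@sub_mono _ _ S); rewrite compA inclE.
    by rewrite -xE -iw compA cokerm0 comp0m.
apply: epiP => Z h h0; apply: epi_eq0 (@quot_proj_epi _ _ _ _ le') _.
apply: gen; first by rewrite -compA -(quot_mapE le le' hS hT) compA h0 comp0m.
by rewrite -compA cokerm0 compm0.
Qed.

(** Serves both for compatibility with [d] and for naturality in the sequence. *)
Lemma quot_map_square (X Y Y' Z : A) (f : hom X Y) (g : hom Y Z)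
    (f' : hom X Y') (g' : hom Y' Z)
    (S T : subobject X) (S1 T1 : subobject Y) (S2 T2 : subobject Y')
    (S3 T3 : subobject Z) (le : sub_le T S) (le1 : sub_le T1 S1)
    (le2 : sub_le T2 S2) (le3 : sub_le T3 S3)
    (fS : maps_into f S S1) (fT : maps_into f T T1)
    (gS : maps_into g S1 S3) (gT : maps_into g T1 T3)
    (f'S : maps_into f' S S2) (f'T : maps_into f' T T2)
    (g'S : maps_into g' S2 S3) (g'T : maps_into g' T2 T3) :
  g ∘ f = g' ∘ f' ->
  quot_map le1 le3 gS gT ∘ quot_map le le1 fS fT =
  quot_map le2 le3 g'S g'T ∘ quot_map le le2 f'S f'T.
Proof.
move=> e; apply: (@quot_proj_epi _ _ _ _ le).
rewrite -!compA !quot_mapE !compA !quot_mapE -!compA; congr (_ ∘ _).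
apply: sub_mono; rewrite !compA !restrE -!compA !restrE !compA.
by rewrite e.
Qed.

(** * Isomorphisms of sequences and powers of the differential *)

Lemma seq_hom_iso (C D : Seq A) (f : hom C D) :
  (forall j, is_iso ((f : seq_hom C D) j)) -> is_iso f.
Proof.
move=> fi; pose g j := sval (boolp.cid (fi j)).
have gf j : g j ∘ (f : seq_hom C D) j = idm _.
  by rewrite /g; case: boolp.cid => ? [].
have fg j : (f : seq_hom C D) j ∘ g j = idm _.
  by rewrite /g; case: boolp.cid => ? [].
have gd j : g (j + 1) ∘ seq_d D j = seq_d C j ∘ g j.
  rewrite -[LHS]compm1 -(fg j) -compA [seq_d D j ∘ _]compA -seq_mapd.
  by rewrite !compA gf comp1m.
by exists (SeqHom gd); split; apply: seq_hom_ext => j /=.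
Qed.

Lemma dpow_leq0 (C : sequence A) (m n : nat) (j : int) (W : A)
    (x : hom W (C j)) :
  (m <= n)%N -> dpow C m j ∘ x = 0 -> dpow C n j ∘ x = 0.
Proof.
move=> mn x0; rewrite -(subnK mn).
have e : j + m%:Z + (n - m)%N%:Z = j + (n - m + m)%N%:Z.
  by rewrite -addrA -PoszD addnC.
by rewrite (dpow_add C e) -!compA x0 !compm0.
Qed.

Lemma dpow_add_to (C : sequence A) (m n : nat) (j : int)
    (e : j + m%:Z = j - n%:Z + (m + n)%N%:Z) :
  dpow C (m + n) (j - n%:Z) = eqhom C e ∘ (dpow C m j ∘ dpow_to C n j).
Proof.
have e1 : j - n%:Z + n%:Z + m%:Z = j + m%:Z by rewrite subrK.
have e2 : j - n%:Z + n%:Z + m%:Z = j - n%:Z + (m + n)%N%:Z by rewrite e1 e.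
rewrite (dpow_add C e2) -(eqhom_comp C e1 e e2) -compA; congr (_ ∘ _).
by rewrite compA (eqhom_dpow C (subrK n%:Z j) e1) -compA.
Qed.

(* If [x = d^b y] up to a cover and [d^a x = 0], then [d^(a+b) y = 0], so [y]
   lies in [ker d^(a+b)] and [x] is already in the image of [d^b] there. *)
Lemma im_d_ker_d (a b N : nat) (C : sequence A) (j : int) (W : A)
    (x : hom W (ker_d A N C j)) (y : hom W (im_d A b C j)) :
  N = (a + b)%N ->
  dpow C a j ∘ (sub_map (ker_d A N C j) ∘ x) = 0 ->
  sub_map (im_d A b C j) ∘ y = sub_map (ker_d A N C j) ∘ x ->
  exists z, sub_map (im_d A b (sub_seq (ker_d A N) C) j) ∘ z = x.
Proof.
move=> NE; subst N => ax yx; set K := sub_seq _ C.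
have [V [e [v [ee vE]]]] := im_sub_lift y.
have [|w wE] := @kerm_factor _ _ _ _ (dpow C (a + b) (j - b%:Z)) v.
  have e1 : j + a%:Z = j - b%:Z + (a + b)%N%:Z.
    by rewrite addnC PoszD addrA subrK.
  rewrite (dpow_add_to C e1) -compA -[_ ∘ dpow_to C b j ∘ v]compA vE yx.
  by rewrite [dpow C a j ∘ _]compA ax comp0m compm0.
have bw : dpow_to K b j ∘ w = x ∘ e.
  apply: (@sub_mono _ _ (ker_d A (a + b) C j)).
  have nat := dpow_to_nat (sub_seq_incl (ker_d A (a + b)) C) b j.
  by rewrite [LHS]compA [_ ∘ dpow_to K b j]nat -compA [_ ∘ w]wE vE yx -compA.
have [u uE] := im_sub_factor (dpow_to K b j).
(* The factorization found on the cover [V] descends to [W]. *)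
apply: (mono_factor_epi (y := u ∘ w) _ ee); first exact: sub_mono.
by rewrite compA [_ ∘ u]uE.
Qed.

Section KernelQuotient.
Variables (a b N : nat) (hN : N = (a + b)%N).

Let K (C : sequence A) : sequence A := sub_seq (ker_d A N) C.

(** A general pair [(S, T)] covers both quotients at once: [imT] and [Tim] place [T] between the
    images of [d^b] on [K] and on [C], and [kTS] says that [ker d^a] and [T] generate [S]. *)
Lemma kapranov_ker_iso (P : Seq A -> Prop) (S T : subfunctor A)
    (le : forall C j, sub_le (T C j) (S C j))
    (dm : forall C j,
       maps_into (dpow C (minn a b) j) (S C j) (T C (j + (minn a b)%:Z)))
    (kS : forall C j, sub_le (ker_d A a C j) (S C j))
    (imT : forall C j, maps_into (sub_map (ker_d A N C j))
       (im_d A b (K C) j) (T C j))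
    (Tim : forall C j, sub_le (T C j) (im_d A b C j))
    (kTS : forall C j (Z : A) (g : hom (S C j) Z),
       g ∘ incl (kS C j) = 0 -> g ∘ incl (le C j) = 0 -> g = 0) :
  naturally_isomorphic
    (functor_comp (kapranov A (eq_leq hN)) (ker_functor P N))
    (quot_functor (fun C (_ : P C) => le C) (fun C _ => dm C)).
Proof.
have kerS C j : maps_into (sub_map (ker_d A N C j)) (ker_d A a (K C) j) (S C j).
  apply: maps_into_le (ex_intro _ _ (compm1 _)) (kS C j) _.
  exact: (ker_d_map a (sub_seq_incl (ker_d A N) C)).
pose le' (X : full_subcategory P) :=
  kapranov_le (eq_leq hN) (svalP (ker_functor P N X)).
pose q (X : full_subcategory P) j :=
  quot_map (le' X j) (le (sval X) j) (kerS (sval X) j) (imT (sval X) j).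
have qd X (j : int) :
    q X (j + 1) ∘ seq_d (quot_seq (le' X)) j =
    seq_d (quot_seq (le (sval X))) j ∘ q X j.
  by apply: quot_map_square; rewrite restrE.
pose eta (X : full_subcategory P) :=
  @SeqHom A (quot_seq (le' X)) (quot_seq (le (sval X))) (q X) (qd X).
exists eta; split=> [X|X Y f]; last first.
  by apply: seq_hom_ext => j; apply: quot_map_square; rewrite restrE.
apply: seq_hom_iso => j; pose C : sequence A := sval X.
have nat := dpow_nat (sub_seq_incl (ker_d A N) C) a j.
have ker_aN : dpow C N j ∘ kerm (dpow C a j) = 0.
  by apply: dpow_leq0 (kerm0 _); rewrite hN leq_addr.
apply: quot_map_iso => [W x y yE|Z g g0].
  (* Mono: [T] lies in [im d^b] and [x] is killed by [d^a]. *)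
  have [i iE] := Tim C j; rewrite -iE -compA in yE.
  apply: (im_d_ker_d hN _ yE).
  rewrite compA -[_ ∘ sub_map _]nat -compA [X in _ ∘ X]compA.
  by rewrite [_ ∘ sub_map _]kerm0 comp0m compm0.
apply: kTS.
(* Epi: the inclusion of [ker d^a] lifts to [t] into [K], then to [s] into the kernel of [d^a] on
   [K], where [g] vanishes. *)
have [t tE] := kerm_factor ker_aN.
have [|s sE] := @kerm_factor _ _ _ _ (dpow (K C) a j) t.
  apply: (@sub_mono _ _ (ker_d A N C (j + a%:Z))).
  by rewrite compm0 compA [_ ∘ dpow (K C) a j]nat -compA [_ ∘ t]tE kerm0.
have <- : restr (kerS C j) ∘ s = incl (kS C j).
  apply: (@sub_mono _ _ (S C j)).
  by rewrite [RHS](inclE (kS C j)) compA restrE -compA [_ ∘ s]sE.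
by rewrite compA g0 comp0m.
Qed.

End KernelQuotient.
End AbelianFacts.

Theorem proposition8 (A : abelian_category) (a b N : nat)
    (ha : (0 < a)%N) (hb : (0 < b)%N) (hN : N = (a + b)%N)
    (P : Seq A -> Prop) (hP : forall C : Seq A, is_complex N C -> P C) :
  naturally_isomorphic
    (functor_comp (kapranov A (eq_leq hN)) (ker_functor P N))
    (ker_mod_meet P a b) /\
  naturally_isomorphic
    (functor_comp (kapranov A (eq_leq hN)) (ker_functor P N))
    (join_mod_im P a b).
Proof.
have im_im (C : sequence A) j : maps_into (sub_map (ker_d A N C j))
    (im_d A b (sub_seq (ker_d A N) C) j) (im_d A b C j).
  exact: (im_d_map b (sub_seq_incl (ker_d A N) C)).
split.
- apply: (@kapranov_ker_iso _ _ _ _ hN P (ker_d A a)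
    (meetf (ker_d A a) (im_d A b)) (ker_meet_le a b) (ker_meet_dmin a b)
    (fun C j => ex_intro _ _ (compm1 _))).
  + move=> C j; apply: maps_into_meet; last exact: im_im.
    (* On the [N]-complex [K], [d^a d^b = 0]. *)
    have leK := kapranov_le (eq_leq hN) (ker_d_complex N C) j.
    apply: maps_into_le leK (ex_intro _ _ (compm1 _)) _.
    exact: (ker_d_map a (sub_seq_incl (ker_d A N) C)).
  + by move=> C j; apply: sub_meet_le2.
  (* Here [S] is [ker d^a], so the inclusion in [g0] is the identity. *)
  + move=> C j Z g g0 _; rewrite -(compm1 g) -g0; congr (_ ∘ _).
    by apply: (@sub_mono _ _ (ker_d A a C j)); rewrite inclE compm1.
- apply: (@kapranov_ker_iso _ _ _ _ hN P (joinf (ker_d A a) (im_d A b))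
    (im_d A b) (join_im_le a b) (join_im_dmin a b)
    (fun C j => sub_join_ge1 _ _) im_im).
  + by move=> C j; exists (idm _); rewrite compm1.
  + by move=> C j Z g; apply: sub_join_ext.
Qed.
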